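(* Let $(A,f)$ be a connected affine quandle of finite order. Then the quandle ring $\mathbb{C}[A]$ decomposes multiplicity free as a direct sum of simple right ideals; that is, the permutation representation $\rho:Inn(A)\to GL(\mathbb{C}[A])$, $\rho(g)(x)=g(x)$ for $x\in A$, is a direct sum of pairwise inequivalent irreducible representations of $Inn(A)$.
   Context: For an additive abelian group $A$ and $f\in Aut(A)$, the affine quandle $(A,f)$ is the set $A$ with the operation $x\triangleright y=f(x)+(id_A-f)(y)$. For $y\in A$ let $R_y(x)=x\triangleright y$, which is a permutation of $A$; $Inn(A)$ is the group of permutations of $A$ generated by all $R_y$, $y \in A$. The quandle is connected if $Inn(A)$ acts transitively on $A$. The quandle ring $\mathbb{C}[A]$ is the complex vector space with basis the set $A$ and with bilinear (generally non-associative) multiplication extending $\triangleright$. A right ideal is a subspace closed under right multiplication by $\mathbb{C}[A]$, equivalently a $\rho$-invariant subspace; decompositions of $\mathbb{C}[A]$ into simple right ideals are the same as decompositions of $\rho$ into irreducible representations of $Inn(A)$. A representation of a finite group is multiplicity free if each irreducible representation occurs in it with multiplicity at most one. *)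

(* Defs.v *)
From HB Require Import structures.
From mathcomp Require Import all_boot all_order all_algebra all_fingroup.
From mathcomp Require Import mxrepresentation.
From mathcomp Require Import reals complex.

Set Implicit Arguments.
Unset Strict Implicit.
Unset Printing Implicit Defensive.

Import GroupScope GRing.Theory.
Local Open Scope ring_scope.

Section AffineQuandle.

Variables (A : finZmodType) (f : {perm A}).

Definition affine_op (x y : A) : A := f x + (y - f y).

Lemma affine_op_inj (y : A) : injective (affine_op^~ y).
Proof. by move=> x1 x2 /addIr /perm_inj. Qed.

Definition right_translation (y : A) : {perm A} := perm (@affine_op_inj y).

Definition Inn : {group {perm A}} := <<[set right_translation y | y : A]>>%G.

Definition connected_affine : bool := [transitive Inn, on [set: A] | 'P].

End AffineQuandle.

(* The vector space F[T] with basis T is modelled by row vectors indexed by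
   the enumeration of T. As in mxalgebra, a subspace of F[T] is the row space
   of a square matrix. *)
Section LinearSpan.

Variables (F : fieldType) (T : finType).

Definition basis_vec (x : T) : 'rV[F]_#|T| := delta_mx 0 (enum_rank x).

Definition bilin_mul (op : T -> T -> T) (u v : 'rV[F]_#|T|) : 'rV[F]_#|T| :=
  \sum_x \sum_y
    (u 0 (enum_rank x) * v 0 (enum_rank y)) *: basis_vec (op x y).

Definition right_ideal (op : T -> T -> T) (U : 'M[F]_#|T|) : Prop :=
  forall u v : 'rV[F]_#|T|, (u <= U)%MS -> (bilin_mul op u v <= U)%MS.

Definition simple_right_ideal (op : T -> T -> T) (U : 'M[F]_#|T|) : Prop :=
  [/\ right_ideal op U, U != 0
    & forall W : 'M[F]_#|T|,
        right_ideal op W -> (W <= U)%MS -> W != 0 -> (U <= W)%MS].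

(* Matrices act on row vectors from the right: see [basis_vec_perm]. *)
Definition perm_rep_mx (s : {perm T}) : 'M[F]_#|T| :=
  \matrix_(i < #|T|) basis_vec (s (enum_val i)).

Lemma basis_vec_perm (s : {perm T}) (x : T) :
  basis_vec x *m perm_rep_mx s = basis_vec (s x).
Proof. by rewrite -rowE rowK enum_rankK. Qed.

Lemma perm_rep_mx_repr (G : {group {perm T}}) : mx_repr G perm_rep_mx.
Proof.
split=> [|s t _ _]; apply/row_matrixP=> i.
  by rewrite rowK perm1 rowE mulmx1 /basis_vec enum_valK.
by rewrite row_mul !rowK basis_vec_perm permM.
Qed.

Definition perm_rep (G : {group {perm T}}) : mx_representation F G #|T| :=
  MxRepresentation (perm_rep_mx_repr G).

End LinearSpan.

(* Main.v *)
Require Import Defs.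
From mathcomp Require Import all_boot all_order all_algebra all_fingroup.
From mathcomp Require Import mxrepresentation.
From mathcomp Require Import reals complex.
From mathcomp Require Import pgroup boolp.

Import GroupScope GRing.Theory Num.Theory.
Local Open Scope ring_scope.

(** The point is that Inn contains a regular abelian group. In a connected
    affine quandle the map 1 - f is onto: its image contains 0 and is stable
    under every right translation, hence contains the orbit of 0, which is all
    of A ([connected_sub_surj]). Since R_0 = f, the permutation R_0^-1 R_y is
    the translation by y - f y, so Inn contains every translation of A
    ([translation_in_Inn]).

    Any matrix that commutes with rho then commutes with all translations. A
    matrix commuting with a transitive abelian set of permutations is
    determined by the image of a single basis vector, and therefore is a linear
    combination of those permutations; so the commutant of rho is commutative
    ([transitive_abelian_commutant]).

    Finally, a completely reducible representation with a commutative commutant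
    is multiplicity free: an isomorphism between two distinct summands U and V,
    precomposed with the projection onto U, fails to commute with that
    projection ([commutative_commutant_not_iso]). Complete reducibility is
    Maschke's theorem. Simple submodules are simple right ideals because right
    multiplication by a basis vector y acts as rho(R_y) ([right_idealP]). *)

Section RightIdeals.

Variables (F : fieldType) (T : finType) (op : T -> T -> T) (rt : T -> {perm T}).
Hypothesis rtE : forall x y, rt y x = op x y.

Lemma row_basis_vec (u : 'rV[F]_#|T|) :
  u = \sum_x u 0 (enum_rank x) *: basis_vec F x.
Proof.
rewrite {1}[u]row_sum_delta (reindex enum_rank) //=.
by apply: onW_bij; apply: enum_rank_bij.
Qed.

Lemma bilin_mulE (u v : 'rV[F]_#|T|) :
  bilin_mul op u v =
  \sum_y v 0 (enum_rank y) *: (u *m perm_rep_mx F (rt y)).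
Proof.
rewrite /bilin_mul exchange_big /=; apply: eq_bigr => y _.
rewrite {2}[u]row_basis_vec mulmx_suml scaler_sumr; apply: eq_bigr => x _.
by rewrite -scalemxAl basis_vec_perm rtE scalerA mulrC.
Qed.

Lemma bilin_mul_basis_vec (u : 'rV[F]_#|T|) (y : T) :
  bilin_mul op u (basis_vec F y) = u *m perm_rep_mx F (rt y).
Proof.
rewrite bilin_mulE (bigD1 y) //= mxE !eqxx scale1r big1 ?addr0 // => z zy.
by rewrite mxE eqxx /= (inj_eq enum_rank_inj) (negPf zy) scale0r.
Qed.

(** Right multiplication by an arbitrary vector is a combination of the
    operators of the generators, and the elements that stabilise U form a
    group; hence both conditions reduce to stability under the generators. *)
Lemma right_idealP (U : 'M[F]_#|T|) :
  right_ideal op U <->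
  mxmodule (perm_rep F <<[set rt y | y : T]>>%G) U.
Proof.
split=> [idU | /mxmoduleP modU u v uU].
  rewrite /mxmodule gen_subG; apply/subsetP => _ /imsetP[y _ ->].
  rewrite inE mem_gen ?imset_f //=; apply/row_subP => i.
  by rewrite row_mul -bilin_mul_basis_vec; apply/idU/row_sub.
rewrite bilin_mulE; apply: summx_sub => y _; apply: scalemx_sub.
apply: submx_trans (submxMr _ uU) _.
by apply: (modU (rt y)); rewrite mem_gen ?imset_f.
Qed.

Lemma simple_right_ideal_mxsimple (U : 'M[F]_#|T|) :
  mxsimple (perm_rep F <<[set rt y | y : T]>>%G) U -> simple_right_ideal op U.
Proof.
case=> modU nzU minU; split=> // [|W /right_idealP]; last exact: minU.
exact/right_idealP.
Qed.

End RightIdeals.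

(** With e the basis vector at x0, write e M as a combination of the basis
    vectors e h_y, where h_y in H sends x0 to y. The same combination P of the
    operators of the h_y agrees with M at e, and both commute with H, so by
    transitivity they agree everywhere. Now N commutes with P = M. *)
Lemma transitive_abelian_commutant (F : fieldType) (T : finType)
    (H : {set {perm T}}) (x0 : T) (M N : 'M[F]_#|T|) :
  abelian H -> (forall y, exists2 s, s \in H & s x0 = y) ->
  {in H, forall s, comm_mx M (perm_rep_mx F s)} ->
  {in H, forall s, comm_mx N (perm_rep_mx F s)} ->
  comm_mx M N.
Proof.
move=> abH trH cM cN.
have /fin_all_exists2[h hH hE] y : exists2 s, s \in H & s x0 = y := trH y.
have rep_comm :
    {in H &, forall s t, comm_mx (perm_rep_mx F s) (perm_rep_mx F t)}.
  move=> s t sH tH; have [_ repM] := perm_rep_mx_repr F [set: {perm T}]%G.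
  by rewrite /comm_mx -!repM ?inE // (centsP abH s sH t tH).
pose P := \sum_y (basis_vec F x0 *m M) 0 (enum_rank y) *: perm_rep_mx F (h y).
have cP s : s \in H -> comm_mx P (perm_rep_mx F s).
  move=> sH; rewrite /comm_mx mulmx_suml mulmx_sumr; apply: eq_bigr => y _.
  by rewrite -scalemxAl -scalemxAr rep_comm.
have MP0 : basis_vec F x0 *m M = basis_vec F x0 *m P.
  rewrite [LHS]row_basis_vec mulmx_sumr; apply: eq_bigr => y _.
  by rewrite -scalemxAr basis_vec_perm hE.
have -> : M = P.
  apply/row_matrixP => i; rewrite !rowE -(enum_valK i) -/(basis_vec F _).
  rewrite -(hE (enum_val i)) -basis_vec_perm -!mulmxA.
  rewrite -(cM _ (hH _)) -(cP _ (hH _)).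
  by rewrite !mulmxA MP0.
rewrite /comm_mx mulmx_suml mulmx_sumr; apply: eq_bigr => y _.
by rewrite -scalemxAl -scalemxAr cN.
Qed.

(** Let p be the projection onto U along W and g an isomorphism from U to V.
    Both p and p g belong to the commutant; on U one has p (p g) = g, while
    (p g) p = 0 because U g = V lies in W = ker p. Hence commutation would force
    U g = 0. *)
Lemma commutative_commutant_not_iso (F : fieldType) (gT : finGroupType)
    (G : {group gT}) (n : nat) (rG : mx_representation F G n)
    (U V W : 'M[F]_n) :
  (forall M N, centgmx rG M -> centgmx rG N -> comm_mx M N) ->
  mxmodule rG U -> mxmodule rG W -> U != 0 ->
  (U :&: W = 0)%MS -> (1%:M <= U + W)%MS -> (V <= W)%MS -> ~ mx_iso rG U V.
Proof.
move=> commC modU modW nzU dxUW fullUW sVW [g g_unit homg defV].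
pose p := proj_mx U W.
have homp : (1%:M <= dom_hom_mx rG p)%MS.
  by apply: submx_trans fullUW _; apply: proj_mx_hom.
have pG x : x \in G -> rG x *m p = p *m rG x.
  by move=> Gx; have /hom_mxP/(_ x Gx) := homp; rewrite !mul1mx.
have cp : centgmx rG p by apply/centgmxP => x Gx; rewrite pG.
have cpg : centgmx rG (p *m g).
  apply/centgmxP => x Gx; rewrite mulmxA pG //.
  have /hom_mxP/(_ x Gx) := submx_trans (proj_mx_sub U W 1%:M) homg.
  by rewrite !mul1mx.
have Up : U *m p = U by apply: proj_mx_id.
have Ugp : U *m g *m p = 0.
  by apply: proj_mx_0 => //; apply: submx_trans sVW; rewrite defV.
(* By definition p is itself a product, which associativity must not open. *)
clearbody p.
have /(congr1 (mulmx U)) := commC _ _ cp cpg.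
rewrite !mulmxA Up Up Ugp => Ug0.
by case/eqP: nzU; rewrite -(mulmxK g_unit U) Ug0 mul0mx.
Qed.

Lemma commutative_commutant_multiplicity_free (F : fieldType)
    (gT : finGroupType) (G : {group gT}) (n : nat)
    (rG : mx_representation F G n) :
  [pchar F]^'.-group G ->
  (forall M N, centgmx rG M -> centgmx rG N -> comm_mx M N) ->
  exists (k : nat) (V : 'I_k -> 'M[F]_n),
    [/\ (\sum_(i < k) V i :=: 1%:M)%MS,
        mxdirect (\sum_(i < k) V i)%MS,
        forall i, mxsimple rG (V i)
      & forall i j, i != j -> ~ mx_iso rG (V i) (V j)].
Proof.
move=> charG commC.
(* Decompositions into simples exist only classically over a general field;
   passing to a boolean goal removes the double negation. *)
apply/asboolP; apply: (mx_reducible_semisimple (mxmodule1 rG)).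
  exact: mx_Maschke_pchar.
case=> I U /= simU defU dxU; apply/asboolP.
pose V (i : 'I_#|I|) := U (enum_val i).
have defV : (\sum_(i < #|I|) V i = \sum_i U i)%MS.
  rewrite [RHS](reindex (@enum_val I I)) //=.
  by apply: onW_bij; apply: enum_val_bij.
have dxV : mxdirect (\sum_(i < #|I|) V i).
  rewrite mxdirectE /= defV (mxdirectP dxU) /= (reindex (@enum_val I I)) //=.
  by apply: onW_bij; apply: enum_val_bij.
exists #|I|, V; split=> // [|i|i j ij].
- by rewrite defV.
- exact: simU.
pose W := (\sum_(l < #|I| | l != i) V l)%MS.
apply: (commutative_commutant_not_iso _ _ _ _ _ _ _ W).
- exact: commC.
- by case: (simU (enum_val i)).
- by apply: sumsmx_module => l _; case: (simU (enum_val l)).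
- by case: (simU (enum_val i)).
- by have /mxdirect_sumsP := dxV; apply.
- by rewrite -defU -defV (bigD1 i).
by rewrite (sumsmx_sup j) // eq_sym.
Qed.

Section ConnectedAffine.

Variables (A : finZmodType) (f : {perm A}).
Hypothesis f_Aut : f \in Aut [set: A].

Definition translation (a : A) : {perm A} := perm (addIr a).

Lemma translations_abelian : abelian [set translation a | a : A].
Proof.
apply/centsP => _ /imsetP[a _ ->] _ /imsetP[b _ ->].
by apply/permP => x; rewrite !permM !permE addrAC.
Qed.

Lemma autD : {morph f : x y / x + y}.
Proof. by move=> x y; apply: (morphicP (Aut_morphic f_Aut)); rewrite inE. Qed.

Lemma aut0 : f 0 = 0.
Proof. by apply: (addIr (f 0)); rewrite -autD !add0r. Qed.

(** The image of 1 - f contains 0 and is stable under right translations: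
    R_y (x - f x) = (1 - f) (f x + y). *)
Lemma connected_sub_surj (a : A) : connected_affine f -> exists y, a = y - f y.
Proof.
move=> conn; pose I := [set y - f y | y : A].
have InnI : Inn f \subset 'N(I | 'P).
  rewrite gen_subG; apply/subsetP => _ /imsetP[y _ ->].
  rewrite inE; apply/andP; split; first by rewrite inE.
  rewrite inE; apply/subsetP => _ /imsetP[x _ ->]; rewrite inE /= /aperm permE.
  apply/imsetP; exists (f x + y) => //.
  have fB : f (x - f x) = f x - f (f x).
    by apply: (addIr (f (f x))); rewrite -autD !subrK.
  by rewrite /affine_op fB autD addrACA -opprD.
have I0 : 0 \in I by apply/imsetP; exists 0; rewrite ?aut0 ?subrr.
have [s sInn sa] := atransP2 conn (in_setT 0) (in_setT a).
have := astabs_act 0 (subsetP InnI s sInn); rewrite -sa I0 => aI.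
by have /imsetP[y _ ->] := aI; exists y.
Qed.

Lemma translation_in_Inn (a : A) :
  connected_affine f -> translation a \in Inn f.
Proof.
move=> /(connected_sub_surj a)[y ->].
have R0 : right_translation f 0 = f.
  by apply/permP => x; rewrite permE /affine_op aut0 subr0 addr0.
have -> : translation (y - f y) =
    ((right_translation f 0)^-1 * right_translation f y)%g.
  by apply/permP => x; rewrite R0 permM [LHS]permE [RHS]permE /affine_op permKV.
by rewrite groupM ?groupV // mem_gen ?imset_f.
Qed.

End ConnectedAffine.

Theorem theorem8p10 (R : realType) (A : finZmodType) (f : {perm A}) :
  f \in Aut [set: A] -> connected_affine f ->
  exists (k : nat) (V : 'I_k -> 'M[R[i]]_#|A|),
    [/\ (\sum_(i < k) V i :=: 1%:M)%MS,
        mxdirect (\sum_(i < k) V i)%MS,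
        forall i : 'I_k, simple_right_ideal (affine_op f) (V i),
        forall i : 'I_k, mxsimple (perm_rep R[i] (Inn f)) (V i)
      & forall i j : 'I_k,
          i != j -> ~ mx_iso (perm_rep R[i] (Inn f)) (V i) (V j)].
Proof.
move=> f_Aut conn.
have charInn : [pchar R[i]]^'.-group (Inn f).
  by apply/pgroupP => p _ _; rewrite inE /= pchar_num.
have commC M N : centgmx (perm_rep R[i] (Inn f)) M ->
    centgmx (perm_rep R[i] (Inn f)) N -> comm_mx M N.
  move=> /centgmxP cM /centgmxP cN.
  have abT := translations_abelian A.
  apply: (transitive_abelian_commutant _ _ _ 0 _ _ abT) => [y|s|s].
  - by exists (translation A y); rewrite ?imset_f // permE add0r.
  - by case/imsetP=> a _ ->; apply: cM; apply: translation_in_Inn.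
  - by case/imsetP=> a _ ->; apply: cN; apply: translation_in_Inn.
have [k [V [defV dxV simV isoV]]] :=
  commutative_commutant_multiplicity_free _ _ _ _ _ charInn commC.
exists k, V; split=> // i.
apply: (simple_right_ideal_mxsimple _ _ _ (right_translation f)) => //.
by move=> x y; rewrite permE.
Qed.
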